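(* Consider a convex multiobjective optimization problem $\min (f_1(x),\dots,f_m(x))$ subject to $c_1(x)\ge 0,\dots,c_l(x)\ge 0$ in $x\in\mathbb{R}^n$ whose objectives have the form $f_i(x)=h(x)+d_i^Tx$ ($i=1,\dots,m$), where $h$ is a common convex polynomial and $d_1,\dots,d_m\in\mathbb{R}^n$. Assume $C(x)$ is nonsingular and let $\ell_i(x)$, $u_{ij}(x)$ and $P(x)$ be as in the context. Then the equation $P(x)w=e_{n+l+1}$ in $w\in\mathbb{R}^m$ reduces (i.e. is equivalent) to $$\begin{bmatrix}\bar c_1(x)&\cdots&\bar c_m(x)\\ v_{11}(x)c_1(x)&\cdots&v_{1m}(x)c_1(x)\\ \vdots&&\vdots\\ v_{l1}(x)c_l(x)&\cdots&v_{lm}(x)c_l(x)\\ 1&\cdots&1\end{bmatrix}w=\begin{bmatrix}\nabla h(x)-\sum_{i=1}^l h_i(x)\nabla c_i(x)\\ -h_1(x)c_1(x)\\ \vdots\\ -h_l(x)c_l(x)\\ 1\end{bmatrix},$$ where $$v_{ij}(x)=\ell_i(x)^Td_j,\qquad h_i(x)=\ell_i(x)^T\nabla h(x),\qquad \bar c_j(x)=\sum_{i=1}^l v_{ij}(x)\nabla c_i(x)-d_j.$$ Moreover, in the case $K=\mathbb{R}^n$ (no constraints), if the matrix $D=\begin{bmatrix}d_1&\cdots&d_m\\ 1&\cdots&1\end{bmatrix}$ has full column rank, then the weight vector (the solution $w$ of this equation) can be expressed as $$w(x)=(D^TD)^{-1}D^T\hat h_1(x),\qquad \hat h_1(x)=\begin{bmatrix}-\nabla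 h(x)\\ 1\end{bmatrix}.$$
   Context: The $f_i$ are convex polynomials and the $c_i$ are concave polynomials; $K=\{x\in\mathbb{R}^n: c_i(x)\ge 0,\ i=1,\dots,l\}$. The matrix polynomial $C(x)$ is the $(n+l)\times l$ matrix whose top $n\times l$ block is $[\nabla c_1(x)\ \cdots\ \nabla c_l(x)]$ and whose bottom $l\times l$ block is $\operatorname{diag}(c_1(x),\dots,c_l(x))$. It is nonsingular if $\operatorname{rank}C(x)=l$ for all $x\in\mathbb{C}^n$, in which case there is a real matrix polynomial $C'(x)$ of size $l\times(n+l)$ with $C'(x)C(x)=I_l$; fix one. Let $\ell_i(x)^T$ be the $i$th row of the submatrix formed by the first $n$ columns of $C'(x)$, and $u_{ij}(x)=\ell_i(x)^T\nabla f_j(x)$. The matrix polynomial $P(x)$ of size $(n+l+1)\times m$ has $j$th column $$\Big(\textstyle\sum_{i=1}^l u_{ij}(x)\nabla c_i(x)-\nabla f_j(x),\ u_{1j}(x)c_1(x),\ \dots,\ u_{lj}(x)c_l(x),\ 1\Big)^T.$$ Here $e_{n+l+1}$ is the last standard unit vector of $\mathbb{R}^{n+l+1}$. The equation $P(x)w=e_{n+l+1}$ is the system satisfied by the weight vector $w$ ($w\ge0$, $\sum_j w_j=1$) at a weakly Pareto point $x$ after eliminating the Lagrange multipliers. When $K=\mathbb{R}^n$ we have $l=0$ and the terms involving the $c_i$ are absent. *)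

(* Defs.v *)
From HB Require Import structures.
From mathcomp Require Import all_boot all_order all_algebra.
From mathcomp Require Import complex mpoly reals.
From mathcomp Require classical_sets convex.

Set Implicit Arguments.
Unset Strict Implicit.
Unset Printing Implicit Defensive.

Import GRing.Theory Num.Theory.
Local Open Scope ring_scope.

(* Points are column vectors, whereas [meval] takes a function on indices. *)
Definition pt (S : Type) (n : nat) (x : 'cV[S]_n) : 'I_n -> S := fun k => x k ord0.

Definition evalmx (S : nzRingType) (n p q : nat) (x : 'cV[S]_n)
    (M : 'M[{mpoly S[n]}]_(p, q)) : 'M[S]_(p, q) :=
  map_mx (meval (pt x)) M.

Section Problem.

Variables (R : realType) (n m l : nat).

Implicit Types (p h : {mpoly R[n]}) (f : 'I_m -> {mpoly R[n]}).
Implicit Types (c : 'I_l -> {mpoly R[n]}) (d : 'I_m -> 'cV[R]_n).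

Definition convex_mpoly p : Prop :=
  convex.convex_function (E := 'cV[R]_n) (@classical_sets.setT _)
    (fun x : 'cV[R]_n => p.@[pt x]).

Definition concave_mpoly p : Prop := convex_mpoly (- p).

Definition grad p : 'cV[{mpoly R[n]}]_n := \col_k p^`M(k).

Definition dotp (S : nzRingType) (q : nat) (a b : 'cV[S]_q) : S :=
  (a^T *m b) ord0 ord0.

Definition constv (a : 'cV[R]_n) : 'cV[{mpoly R[n]}]_n := map_mx (@mpolyC n R) a.

Definition linform (a : 'cV[R]_n) : {mpoly R[n]} :=
  \sum_(k < n) a k ord0 *: 'X_k.

Definition Cmx c : 'M[{mpoly R[n]}]_(n + l, l) :=
  col_mx (\matrix_(k < n, i < l) grad (c i) k ord0)
         (diag_mx (\row_(i < l) c i)).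

Definition nonsingular (q r : nat) (M : 'M[{mpoly R[n]}]_(q, r)) : Prop :=
  forall z : 'cV[R[i]]_n,
    \rank (evalmx z (map_mx (map_mpoly (real_complex R)) M)) = r.

Section Eliminated.

(* [C'] is the chosen left inverse of [Cmx c]. *)
Variable C' : 'M[{mpoly R[n]}]_(l, n + l).

Definition ell (i : 'I_l) : 'cV[{mpoly R[n]}]_n := (row i (lsubmx C'))^T.

Definition umult f (i : 'I_l) (j : 'I_m) : {mpoly R[n]} := dotp (ell i) (grad (f j)).

Definition Pmx f c : 'M[{mpoly R[n]}]_(n + l + 1, m) :=
  \matrix_(r, j)
    (col_mx (col_mx (\sum_(i < l) umult f i j *: grad (c i) - grad (f j))
                    (\col_(i < l) (umult f i j * c i)))
            (const_mx 1)) r ord0.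

Definition vmult d (i : 'I_l) (j : 'I_m) : {mpoly R[n]} := dotp (ell i) (constv (d j)).

Definition hcoef h (i : 'I_l) : {mpoly R[n]} := dotp (ell i) (grad h).

Definition cbar c d (j : 'I_m) : 'cV[{mpoly R[n]}]_n :=
  \sum_(i < l) vmult d i j *: grad (c i) - constv (d j).

Definition reduced_lhs c d : 'M[{mpoly R[n]}]_(n + l + 1, m) :=
  \matrix_(r, j)
    (col_mx (col_mx (cbar c d j) (\col_(i < l) (vmult d i j * c i)))
            (const_mx 1)) r ord0.

Definition reduced_rhs h c : 'cV[{mpoly R[n]}]_(n + l + 1) :=
  col_mx (col_mx (grad h - \sum_(i < l) hcoef h i *: grad (c i))
                 (\col_(i < l) (- hcoef h i * c i)))
         (const_mx 1).

End Eliminated.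

Definition e_last : 'cV[R]_(n + l + 1) := delta_mx (rshift (n + l) ord0) ord0.

Definition Dmx d : 'M[R]_(n + 1, m) :=
  col_mx (\matrix_(k < n, j < m) d j k ord0) (const_mx 1).

Definition hhat1 h : 'cV[{mpoly R[n]}]_(n + 1) := col_mx (- grad h) (const_mx 1).

End Problem.

Arguments e_last {R n l}.

(* Main.v *)
Require Import Defs.
From mathcomp Require Import all_boot all_order all_algebra.
From mathcomp Require Import complex mpoly reals.
Import GRing.Theory Num.Theory.
Local Open Scope ring_scope.

(** Since [grad (f j) = grad h + d j], every column of [P] is the corresponding
    column of the reduced matrix shifted by the same vector [e - r], where [r]
    is the reduced right-hand side. Hence [P w = L w + (sum w) (e - r)], and the
    last row of either system forces [sum w = 1]. Without constraints the
    reduced system is [D w = hhat1], whose solution is read off the normal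
    equations: over the reals the Gram matrix of an injective matrix is
    invertible. *)

Lemma matrix_of_col_mx (T : Type) (p q m : nat)
    (F : 'I_m -> 'cV[T]_p) (G : 'I_m -> 'cV[T]_q) :
  \matrix_(r < p + q, j < m) col_mx (F j) (G j) r ord0 =
  col_mx (\matrix_(r, j) F j r ord0) (\matrix_(r, j) G j r ord0).
Proof.
apply/matrixP => r j; rewrite mxE.
by case: (split_ordP r) => k ->; rewrite ?col_mxEu ?col_mxEd mxE.
Qed.

(** The rank-one term sends [w] to [a - b] times the sum of its entries, which is the difference of
    the two right-hand sides once that sum is 1. *)
Lemma mulmx_shift_eq (S : nzRingType) (p m : nat)
    (A B : 'M[S]_(p + 1, m)) (a b : 'cV[S]_(p + 1)) (w : 'cV[S]_m) :
  A = B + (a - b) *m const_mx 1 ->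
  dsubmx A = const_mx 1 -> dsubmx B = const_mx 1 ->
  dsubmx a = 1%:M -> dsubmx b = 1%:M ->
  A *m w = a <-> B *m w = b.
Proof.
move=> AB dA dB da db.
(* The normalization stays a premise: each direction reads it off the last row of its own system. *)
have AwE (sum1 : const_mx 1 *m w = 1%:M :> 'M_1) : A *m w = B *m w + (a - b).
  by rewrite AB mulmxDl -mulmxA sum1 mulmx1.
split=> E.
  have sum1 : const_mx 1 *m w = 1%:M :> 'M_1 by rewrite -dA mul_dsub_mx E da.
  move: E; rewrite AwE // => /(canRL (addrK _)) ->.
  by rewrite opprB addrCA subrr addr0.
have sum1 : const_mx 1 *m w = 1%:M :> 'M_1 by rewrite -dB mul_dsub_mx E db.
by rewrite AwE // E addrCA subrr addr0.
Qed.

(** If the rows of [K] span the left kernel of the Gram matrix, then [X = K A^T] satisfies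
    [X X^T = 0], so [X = 0] by positivity, and [K = 0] because [A^T] has independent rows. *)
Lemma gram_unitmx (R : realFieldType) (p m : nat) (A : 'M[R]_(p, m)) :
  \rank A = m -> A^T *m A \in unitmx.
Proof.
move=> rkA; rewrite -row_free_unit -kermx_eq0.
have Aker : kermx (A^T *m A) *m A^T = 0.
  set X := _ *m A^T.
  have XXt : X *m X^T = 0.
    by rewrite /X trmx_mul trmxK mulmxA -[_ *m A]mulmxA mulmx_ker mul0mx.
  apply/matrixP => i j; rewrite [RHS]mxE; apply/eqP; rewrite -sqrf_eq0.
  (* The diagonal entry [(i, i)] of [X X^T] is the sum of the squares of row [i] of [X]. *)
  have /matrixP/(_ i i) := XXt; rewrite !mxE => /eqP; rewrite psumr_eq0.
    by move/allP/(_ j (mem_index_enum _)); rewrite !mxE -expr2.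
  by move=> k _; rewrite !mxE -expr2 sqr_ge0.
have freeAt : row_free A^T by rewrite /row_free mxrank_tr rkA.
by apply/eqP/(row_free_inj freeAt); rewrite Aker mul0mx.
Qed.

Section Gradients.

Variables (R : realType) (n : nat).

Lemma grad_linform (a : 'cV[R]_n) : grad (linform a) = constv a.
Proof.
apply/matrixP => k j; rewrite !mxE ord1 /linform linear_sum /=.
rewrite (bigD1 k) //= big1 => [|i ik].
  rewrite addr0 mderivZ mderivX mnm1E eqxx scale1r.
  have -> : (U_(k) - U_(k) = 0 :> 'X_{1..n})%MM.
    by apply/mnmP => i; rewrite mnmBE mnm0E subnn.
  by rewrite mpolyX0 alg_mpolyC.
by rewrite mderivZ mderivX mnm1E (negPf ik) scale0r scaler0.
Qed.

Lemma gradD (p q : {mpoly R[n]}) : grad (p + q) = grad p + grad q.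
Proof. by apply/matrixP => k j; rewrite !mxE mderivD. Qed.

End Gradients.

Section Reduction.

Variables (R : realType) (n m l : nat).
Variables (f : 'I_m -> {mpoly R[n]}) (c : 'I_l -> {mpoly R[n]}).
Variables (h : {mpoly R[n]}) (d : 'I_m -> 'cV[R]_n).
Variable C' : 'M[{mpoly R[n]}]_(l, n + l).

Lemma umultE (i : 'I_l) (j : 'I_m) : f j = h + linform (d j) ->
  umult C' f i j = vmult C' d i j + hcoef C' h i.
Proof.
move=> fE; rewrite /umult /vmult /hcoef /dotp fE gradD grad_linform.
by rewrite mulmxDr [LHS]mxE; exact: addrC.
Qed.

Lemma e_last_col_mx : e_last = col_mx 0 1%:M :> 'cV[R]_(n + l + 1).
Proof.
apply/matrixP => r j; rewrite !ord1 mxE eqxx andbT.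
case: (split_ordP r) => k ->; rewrite ?col_mxEu ?col_mxEd mxE.
  by rewrite eq_lrshift.
by rewrite eq_rshift !ord1.
Qed.

(** Splitting each multiplier by [umultE] separates the contribution of [d j] from that of [h], and
    the latter is the same for all [j]. *)
Lemma Pmx_top_shift (j : 'I_m) : f j = h + linform (d j) ->
  \sum_(i < l) umult C' f i j *: grad (c i) - grad (f j) =
  cbar C' c d j - (grad h - \sum_(i < l) hcoef C' h i *: grad (c i)).
Proof.
move=> fE.
have uE : \sum_(i < l) umult C' f i j *: grad (c i) =
    \sum_(i < l) vmult C' d i j *: grad (c i) +
    \sum_(i < l) hcoef C' h i *: grad (c i).
  rewrite -big_split; apply: eq_bigr => i _.
  by rewrite (umultE i j fE); exact: scalerDl.
rewrite [X in X - grad (f j)]uE fE gradD grad_linform /cbar opprB addrACA.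
by rewrite opprD [- grad h - _]addrC.
Qed.

Lemma PmxE : Pmx C' f c =
  col_mx (col_mx
    (\matrix_(r, j) (\sum_(i < l) umult C' f i j *: grad (c i) - grad (f j)) r ord0)
    (\matrix_(i, j) (umult C' f i j * c i)))
  (const_mx 1).
Proof.
rewrite /Pmx matrix_of_col_mx; congr col_mx.
  rewrite matrix_of_col_mx; congr col_mx.
  by apply/matrixP => r j; rewrite !mxE.
by apply/matrixP => r j; rewrite !mxE.
Qed.

Lemma reduced_lhsE : reduced_lhs C' c d =
  col_mx (col_mx (\matrix_(r, j) cbar C' c d j r ord0)
                 (\matrix_(i, j) (vmult C' d i j * c i)))
         (const_mx 1).
Proof.
rewrite /reduced_lhs matrix_of_col_mx; congr col_mx.
  rewrite matrix_of_col_mx; congr col_mx.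
  by apply/matrixP => r j; rewrite !mxE.
by apply/matrixP => r j; rewrite !mxE.
Qed.

(** Multiplying a column by the row of ones copies it into every column, so this is the columnwise
    shift; [col_mx 0 1%:M] is the last unit vector over the polynomial ring. *)
Lemma Pmx_shift : (forall j, f j = h + linform (d j)) ->
  Pmx C' f c =
    reduced_lhs C' c d + (col_mx 0 1%:M - reduced_rhs C' h c) *m const_mx 1.
Proof.
move=> fE; rewrite PmxE reduced_lhsE /reduced_rhs.
rewrite opp_col_mx add_col_mx mul_col_mx add_col_mx.
rewrite sub0r opp_col_mx mul_col_mx add_col_mx.
have mul1 (q : nat) (a : 'cV[{mpoly R[n]}]_q) r j :
  (a *m (const_mx 1 : 'rV_m)) r j = a r ord0.
  by rewrite mxE big_ord1 [const_mx 1 _ _]mxE mulr1.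
(* The blocks are, in order, the gradient rows, the rows carrying a factor [c i], and the row of
   ones, where the shift is zero. *)
congr (col_mx (col_mx _ _) _); apply/matrixP => r j; rewrite [RHS]mxE mul1.
- by rewrite [LHS]mxE (Pmx_top_shift _ (fE j)) [LHS]mxE [X in _ = X + _]mxE.
- rewrite [LHS]mxE [X in _ = X + _]mxE [X in _ = _ + X]mxE.
  by rewrite [X in _ - X]mxE (umultE r j (fE j)) mulrDl mulNr opprK.
- by rewrite !mxE !ord1 subrr addr0.
Qed.

End Reduction.

(** For [l = 0] the sums are empty and [cbar] is [- d j]; negating the top block gives [Dmx d] on
    the left and turns [grad h] into [- grad h]. *)
Lemma reduced_unconstrained (R : realType) (n m : nat)
    (c : 'I_0 -> {mpoly R[n]}) (h : {mpoly R[n]}) (d : 'I_m -> 'cV[R]_n)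
    (C' : 'M[{mpoly R[n]}]_(0, n + 0)) (x : 'cV[R]_n) (w : 'cV[R]_m) :
  evalmx x (reduced_lhs C' c d) *m w = evalmx x (reduced_rhs C' h c) ->
  Dmx d *m w = evalmx x (hhat1 h).
Proof.
rewrite reduced_lhsE /evalmx /reduced_rhs /hhat1.
rewrite !map_col_mx !mul_col_mx => /eq_col_mx[/eq_col_mx[top _] bot].
congr col_mx; last first.
  by rewrite -bot; congr mulmx; apply/matrixP => r j; rewrite !mxE rmorph1.
move: top; rewrite big_ord0 subr0 map_mxN => <-; rewrite -mulNmx; congr mulmx.
by apply/matrixP => r j; rewrite !mxE big_ord0 !mxE sub0r rmorphN /= mevalC opprK.
Qed.

Theorem proposition3p5 (R : realType) (n m l : nat)
    (f : 'I_m -> {mpoly R[n]}) (c : 'I_l -> {mpoly R[n]})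
    (h : {mpoly R[n]}) (d : 'I_m -> 'cV[R]_n)
    (C' : 'M[{mpoly R[n]}]_(l, n + l))
    (f_convex : forall j : 'I_m, convex_mpoly (f j))
    (c_concave : forall i : 'I_l, concave_mpoly (c i))
    (h_convex : convex_mpoly h)
    (f_form : forall j : 'I_m, f j = h + linform (d j))
    (C_nonsingular : nonsingular (Cmx c))
    (C'_left_inverse : C' *m Cmx c = 1%:M) :
  (forall (x : 'cV[R]_n) (w : 'cV[R]_m),
     evalmx x (Pmx C' f c) *m w = e_last <->
     evalmx x (reduced_lhs C' c d) *m w = evalmx x (reduced_rhs C' h c))
  /\
  (l = 0%N -> \rank (Dmx d) = m ->
     (Dmx d)^T *m Dmx d \in unitmx /\
     forall (x : 'cV[R]_n) (w : 'cV[R]_m),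
       evalmx x (reduced_lhs C' c d) *m w = evalmx x (reduced_rhs C' h c) ->
       w = invmx ((Dmx d)^T *m Dmx d) *m (Dmx d)^T *m evalmx x (hhat1 h)).
Proof.
have map_const1 (q r : nat) (x : 'cV[R]_n) :
    map_mx (meval (pt x)) (const_mx 1 : 'M_(q, r)) = const_mx 1.
  by apply/matrixP => i j; rewrite !mxE rmorph1.
split=> [x w|l0 rkD].
  apply: mulmx_shift_eq.
  (* Evaluation is a ring morphism, so the polynomial shift identity holds at every point. *)
  - rewrite /evalmx (Pmx_shift R n m l f c h d C' f_form) map_mxD map_mxM map_mxB map_const1.
    by rewrite e_last_col_mx map_col_mx map_mx0 map_scalar_mx rmorph1.
  - by rewrite -map_dsubmx PmxE col_mxKd map_const1.
  - by rewrite -map_dsubmx reduced_lhsE col_mxKd map_const1.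
  - by rewrite e_last_col_mx col_mxKd.
  rewrite -map_dsubmx col_mxKd map_const1.
  by apply/matrixP => i j; rewrite !mxE !ord1.
have unitG := gram_unitmx R _ _ _ rkD; split=> // x w.
(* With [hhat1] replaced by [D w], the Gram matrix cancels against its inverse. *)
subst l => /reduced_unconstrained <-.
by rewrite -mulmxA [_^T *m (_ *m w)]mulmxA mulKmx.
Qed.
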